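(* For $k\in\mathbb Z/5\mathbb Z$ put $\mathbf v_k=\left(\sqrt{\cos\frac{\pi}{5}},\cos\frac{2\pi k}{5},\sin\frac{2\pi k}{5}\right)\in\mathbb R^3$. Let $\mathcal M$ be a von Neumann algebra with a fixed faithful trace $\tau:\mathcal M\to\mathbb C$. Then it is impossible to have positive elements $A_0,\dots,A_4\in\mathcal M$ with $\tau(A_jA_k)=\langle\mathbf v_j,\mathbf v_k\rangle$ for all $j,k\in\mathbb Z/5\mathbb Z$.
   Context: A faithful trace on $\mathcal M$ is a positive linear functional $\tau:\mathcal M\to\mathbb C$ with $\tau(AB)=\tau(BA)$ for all $A,B\in\mathcal M$ and such that $\tau(A^*A)=0$ implies $A=0$. ''Positive element'' means positive semidefinite operator, and $\langle\cdot,\cdot\rangle$ is the standard inner product on $\mathbb R^3$. *)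

(* Defs.v *)
From mathcomp Require Import all_boot all_order all_algebra complex.
From mathcomp Require Import all_classical all_reals all_analysis.

Set Implicit Arguments.
Unset Strict Implicit.
Unset Printing Implicit Defensive.

Import Order.TTheory GRing.Theory Num.Theory.
Import numFieldNormedType.Exports.

Local Open Scope classical_set_scope.
Local Open Scope ring_scope.

Section Operators.
Context {R : realType} {H : completeNormedModType R[i]}.
Implicit Types (ip : {dot H for Num.conj}) (A B : H -> H) (M : set (H -> H)).

(* [ip] is linear in its first argument and conjugate-linear in its second;
   a complete space whose norm comes from [ip] is a Hilbert space. *)
Definition inner_product_norm ip : Prop := forall x : H, `|x| ^+ 2 = ip x x.

(* For linear maps, continuity is boundedness: [linear_bounded_continuous]. *)
Definition bounded_operator A : Prop := linear A /\ continuous A.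

(* B = A^*; such a B is unique, and for bounded A on a Hilbert space it exists
   by the Riesz representation theorem. *)
Definition is_adjoint ip A B : Prop :=
  forall x y : H, ip (A x) y = ip x (B y).

(* On R[i], [0 <= z] says that z is real and nonnegative. *)
Definition positive_operator ip A : Prop := forall x : H, 0 <= ip (A x) x.

(* T is in the closure of M for the weak operator topology: every basic
   neighbourhood of T, given by finitely many seminorms
   A |-> |ip (A x) y| and a radius e, meets M. *)
Definition wot_adherent ip M (T : H -> H) : Prop :=
  forall (s : seq (H * H)) (e : R), 0 < e ->
  exists2 A, M A &
    forall xy, xy \in s -> `|ip (A xy.1 - T xy.1) xy.2| < e%:C%C.

Record von_neumann_algebra ip M : Prop := VonNeumannAlgebra {
  vna_bounded : forall A, M A -> bounded_operator A;
  vna_id : M idfun;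
  vna_linear : forall (a : R[i]) A B, M A -> M B -> M (a *: A + B);
  vna_comp : forall A B, M A -> M B -> M (A \o B);
  vna_adjoint : forall A, M A -> exists2 B, M B & is_adjoint ip A B;
  vna_closed : forall T, bounded_operator T -> wot_adherent ip M T -> M T
}.

(* A functional on M is represented by a function on all maps H -> H, of which
   only the values on M matter. *)
Record faithful_trace ip M (tau : (H -> H) -> R[i]) : Prop := FaithfulTrace {
  trace_linear : forall (a : R[i]) A B, M A -> M B ->
    tau (a *: A + B) = a * tau A + tau B;
  trace_positive : forall A, M A -> positive_operator ip A -> 0 <= tau A;
  trace_comm : forall A B, M A -> M B -> tau (A \o B) = tau (B \o A);
  trace_faithful : forall A B, M A -> is_adjoint ip A B ->
    tau (B \o A) = 0 -> A = 0
}.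

End Operators.

Definition pentagon_vec {R : realType} (k : 'Z_5) : 'rV[R]_3 :=
  \row_(i < 3) [:: Num.sqrt (cos (pi / 5));
                   cos (2 * pi * k%:R / 5);
                   sin (2 * pi * k%:R / 5)]`_i.

Definition inner {R : realType} {n : nat} (x y : 'rV[R]_n) : R :=
  (x *m y^T) 0 0.

(* Main.v *)
(* Since v_j is orthogonal to v_(j+2), traces of the corresponding products
   vanish, and by faithfulness so do the products themselves: A_0 A_2 = A_0 A_3 =
   A_1 A_4 = 0. Also by faithfulness, the A_k satisfy every linear relation
   satisfied by the v_k, in particular those saying that a side of the pentagon
   is parallel to a diagonal:
     A_1 - A_2 = r (A_0 - A_3),  A_4 - A_3 = r (A_0 - A_2),  r = 2 cos (pi/5) - 1.
   Hence A_0 A_1 = A_0 A_4 = r A_0^2, so 0 = A_0 A_1 A_4 = r^2 A_0^3, A_0^2 = 0,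
   and tau (A_0^2) = |v_0|^2 > 0 is contradicted.

   That tau (X A) >= 0 for positive X and A, with X A = 0 in the case of equality,
   is obtained without square roots: after scaling, 0 <= A <= 1, and
   A_0 := A, A_(n+1) := A_n - A_n^2 telescopes to A = \sum_(k < n) A_k^2 + A_n, so
   that tau (X A) >= tau (X A_n), while \sum_k tau (A_k^2) <= tau A forces
   tau (X A_n) -> 0. *)
From HB Require Import structures.
Require Import Defs.
From mathcomp Require Import all_boot all_order all_algebra complex.
From mathcomp Require Import all_classical all_reals all_analysis.
From mathcomp Require Import ring lra.

Set Implicit Arguments.
Unset Strict Implicit.
Unset Printing Implicit Defensive.

Import Order.TTheory GRing.Theory Num.Theory.
Import numFieldNormedType.Exports.

Local Open Scope classical_set_scope.
Local Open Scope ring_scope.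

(** * Geometry of the pentagon vectors *)

Section Pentagon.
Context {R : realType}.

Lemma innerE (n : nat) (x y : 'rV[R]_n) : inner x y = \sum_i x 0 i * y 0 i.
Proof. by rewrite /inner mxE; apply: eq_bigr => i _; rewrite mxE. Qed.

Lemma inner_sum (I : finType) (n : nat) (w : I -> R) (v : I -> 'rV[R]_n) :
  inner (\sum_i w i *: v i) (\sum_i w i *: v i) =
  \sum_i w i * \sum_j w j * inner (v i) (v j).
Proof.
rewrite /inner mulmx_suml summxE; apply: eq_bigr => i _.
rewrite -scalemxAl mxE linear_sum mulmx_sumr summxE; congr (_ * _).
by apply: eq_bigr => j _; rewrite linearZ -scalemxAr mxE.
Qed.

Lemma cos_pi5_gt0 : 0 < cos (pi / 5 : R).
Proof. by have pi0 := pi_gt0 R; apply: cos_gt0_pihalf; lra. Qed.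

Lemma inner_pentagon (j k : 'Z_5) :
  inner (pentagon_vec j) (pentagon_vec k) =
  cos (pi / 5) + cos (2 * pi * (j%:R - k%:R) / 5) :> R.
Proof.
rewrite innerE !big_ord_recl big_ord0 !mxE /= addr0 -expr2.
rewrite sqr_sqrtr ?(ltW cos_pi5_gt0)// mulrBr mulrBl cosB.
by [].
Qed.

(* [cos (3 t) = - cos (2 t)] for [t = pi / 5]; the factor [cos t + 1] of the
   resulting cubic does not vanish. *)
Lemma cos_pi5_root : 4 * cos (pi / 5 : R) ^+ 2 = 2 * cos (pi / 5) + 1.
Proof.
set t : R := pi / 5; have c0 : 0 < cos t := cos_pi5_gt0.
have e3 : cos (t *+ 2 + t) = - cos (t *+ 2).
  by rewrite -[in RHS]cosN -cosDpi; congr cos; rewrite /t; field.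
move: e3; rewrite cosD sin_mulr2n cos_mulr2n => e3.
have s2 := sin2cos2 t.
apply: (mulfI (x := cos t + 1)); first by rewrite gt_eqF//; lra.
by nra.
Qed.

(** The constant first coordinates cancel in each difference, so [r] is the ratio of a side to a
    diagonal of the regular pentagon, the inverse of the golden ratio. *)
Lemma pentagon_chord :
  let r : R := 2 * cos (pi / 5) - 1 in
  pentagon_vec 1 - pentagon_vec 2 = r *: (pentagon_vec 0 - pentagon_vec 3) /\
  pentagon_vec 4 - pentagon_vec 3 = r *: (pentagon_vec 0 - pentagon_vec 2).
Proof.
set t : R := pi / 5 => r.
have q := cos_pi5_root; rewrite -/t in q.
have c1 := cos_mulr2n t; have s1 := sin_mulr2n t.
(* Each angle is written through [t] and multiples of [pi], so that every coordinate becomes a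
   polynomial in [cos t] and [sin t]. *)
have E0 : 2 * pi * (0%R : 'Z_5)%:R / 5 = 0 :> R by rewrite mulr0 mul0r.
have E1 : 2 * pi * (1%R : 'Z_5)%:R / 5 = t *+ 2.
  by rewrite (_ : nat_of_ord _ = 1)// /t; field.
have E2 : 2 * pi * (2%R : 'Z_5)%:R / 5 = - t + pi.
  by rewrite (_ : nat_of_ord _ = 2)// /t; field.
have E3 : 2 * pi * (3%R : 'Z_5)%:R / 5 = t + pi.
  by rewrite (_ : nat_of_ord _ = 3)// /t; field.
have E4 : 2 * pi * (4%R : 'Z_5)%:R / 5 = - (t *+ 2) + pi *+ 2.
  by rewrite (_ : nat_of_ord _ = 4)// /t; field.
split; apply/rowP => -[[|[|[|//]]] ?]; rewrite !mxE ?E0 ?E1 ?E2 ?E3 ?E4 /=;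
  rewrite ?subrr ?mulr0// ?cosD2pi ?sinD2pi ?cosDpi ?sinDpi ?cosN ?sinN
    ?cos0 ?sin0 ?c1 ?s1 /r; set c := cos t in q *.
- by nra.
- by ring.
- by nra.
- by ring.
Qed.

(** Up to sign the angles differ by [pi - pi / 5] or [pi + pi / 5]; the cosine of either is
    [- cos (pi / 5)], which cancels the product of the first coordinates. *)
Lemma pentagon_orthogonal :
  [/\ inner (pentagon_vec 0) (pentagon_vec 2) = 0 :> R,
      inner (pentagon_vec 0) (pentagon_vec 3) = 0 :> R &
      inner (pentagon_vec 1) (pentagon_vec 4) = 0 :> R].
Proof.
have c4 : cos (pi / 5) + cos (- (pi - pi / 5)) = 0 :> R.
  by rewrite cosN [pi - _]addrC cosDpi cosN subrr.
have c6 : cos (pi / 5) + cos (- (pi / 5 + pi)) = 0 :> R.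
  by rewrite cosN cosDpi subrr.
split; rewrite inner_pentagon;
  [rewrite -[RHS]c4|rewrite -[RHS]c6|rewrite -[RHS]c6];
  congr (_ + cos _).
- by rewrite (_ : nat_of_ord 0%R = 0)// (_ : nat_of_ord 2%R = 2)//; field.
- by rewrite (_ : nat_of_ord 0%R = 0)// (_ : nat_of_ord 3%R = 3)//; field.
- by rewrite (_ : nat_of_ord 1%R = 1)// (_ : nat_of_ord 4%R = 4)//; field.
Qed.

Lemma pentagon_norm : inner (pentagon_vec 0) (pentagon_vec 0) != 0 :> R.
Proof.
rewrite inner_pentagon subrr mulr0 mul0r cos0 gt_eqF// ltr_wpDl//.
exact: ltW cos_pi5_gt0.
Qed.

End Pentagon.

(** * Linear maps and composition with finite combinations *)

Section LinearMaps.
Context {K : pzRingType} {U V W : lmodType K}.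
Implicit Types (A : V -> W) (B : U -> V).

Lemma linear_mapD A (lA : linear A) x y : A (x + y) = A x + A y.
Proof. by have := lA 1 x y; rewrite !scale1r. Qed.

Lemma linear_map0 A (lA : linear A) : A 0 = 0.
Proof. by apply: (addrI (A 0)); rewrite -linear_mapD// !addr0. Qed.

Lemma linear_mapZ A (lA : linear A) (a : K) x : A (a *: x) = a *: A x.
Proof. by have := lA a x 0; rewrite linear_map0// !addr0. Qed.

Lemma linear_mapN A (lA : linear A) x : A (- x) = - A x.
Proof. by rewrite -scaleN1r linear_mapZ// scaleN1r. Qed.

Lemma linear_mapB A (lA : linear A) x y : A (x - y) = A x - A y.
Proof. by rewrite linear_mapD// linear_mapN. Qed.

Lemma comp_suml (I : finType) (a : I -> K) (A : I -> V -> W) B :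
  (\sum_i a i *: A i) \o B = \sum_i a i *: (A i \o B).
Proof. by apply/funext => x; rewrite /= !fct_sumE. Qed.

Lemma comp_sumr (I : finType) (a : I -> K) A (B : I -> U -> V) :
  linear A -> A \o (\sum_i a i *: B i) = \sum_i a i *: (A \o B i).
Proof.
move=> lA; apply/funext => x; rewrite /= !fct_sumE /=.
by elim/big_rec2: _ => [|i y z _ <-]; rewrite ?linear_map0// ?linear_mapD// linear_mapZ.
Qed.
End LinearMaps.

(** * Positive operators on a Hilbert space *)

Section PositiveOperators.
Context {R : realType} {H : completeNormedModType R[i]}.
Context (ip : {dot H for Num.conj}) (ip_norm : inner_product_norm ip).
Implicit Types (A B X : H -> H).

Lemma ipC x y : ip x y = (ip y x)^*.
Proof. by rewrite hermC expr0 mul1r. Qed.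

Lemma ipZl (a : R[i]) x y : ip (a *: x) y = a * ip x y.
Proof. exact: linearZl_LR. Qed.

Lemma ipZr (a : R[i]) x y : ip x (a *: y) = a^* * ip x y.
Proof. exact: linearZr_LR. Qed.

(** Positivity makes every [ip (A x) x] real, and over complex scalars polarization turns this into
    symmetry. *)
Lemma positive_self_adjoint A :
  linear A -> positive_operator ip A -> is_adjoint ip A A.
Proof.
move=> lA pA x y; rewrite [RHS]ipC.
(* Polarize with [x + y] and [x + 'i *: y]. *)
set p := ip (A x) y; set q := ip (A y) x.
have e1 : p + q = p^* + q^*.
  have := geC0_conj (pA (x + y)); rewrite (linear_mapD lA) !linearDl !linearDr /=.
  rewrite !rmorphD /= -/p -/q (geC0_conj (pA x)) (geC0_conj (pA y)) => h.
  apply: (addIr (ip (A x) x + ip (A y) y)).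
  by apply: etrans (etrans (esym h) _); ring.
have e2 : q - p = p^* - q^*.
  have := geC0_conj (pA (x + 'i *: y)).
  rewrite (linear_mapD lA) (linear_mapZ lA) !linearDl !linearDr /=.
  rewrite !ipZl !ipZr !rmorphD !rmorphM /= conjCK !conjCi -/p -/q.
  rewrite (geC0_conj (pA x)) (geC0_conj (pA y)) => h.
  apply: (mulfI (neq0Ci (R[i]))).
  apply: (addIr (ip (A x) x + 'i * (- 'i * ip (A y) y))).
  by apply: etrans (etrans (esym h) _); ring.
apply: (mulfI (x := 2)); first by rewrite pnatr_eq0.
have -> : 2 * p = (p + q) - (q - p) by ring.
by rewrite e1 e2; ring.
Qed.

Lemma positive_comp_sq A B :
  is_adjoint ip B B -> positive_operator ip A -> positive_operator ip (B \o A \o B).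
Proof. by move=> sB pA x /=; rewrite sB; apply: pA. Qed.

Lemma positive_sq B : is_adjoint ip B B -> positive_operator ip (B \o B).
Proof. by move=> sB x /=; rewrite sB; apply: dnorm_ge0. Qed.

Lemma positive_scale A (a : R[i]) :
  0 <= a -> positive_operator ip A -> positive_operator ip (a *: A).
Proof. by move=> a0 pA x; rewrite ipZl mulr_ge0. Qed.

Lemma self_adjoint_sum (I : finType) (a : I -> R) (A : I -> H -> H) :
  (forall i, is_adjoint ip (A i) (A i)) ->
  is_adjoint ip (\sum_i (a i)%:C%C *: A i) (\sum_i (a i)%:C%C *: A i).
Proof.
move=> sA x y; rewrite !fct_sumE /=.
elim/big_rec2: _ => [|i z t _ IH]; first by rewrite linear0l linear0r.
rewrite linearDl linearDr /= IH ipZl ipZr sA; congr (_ * _ + _).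
by rewrite conj_Creal//; apply/complex_realP; exists (a i).
Qed.

(** If [|A x| <= c |x|], expanding [0 <= |c x - A x|^2] gives [2 c <A x, x> <= c^2 |x|^2 + |A x|^2
    <= 2 c^2 |x|^2], so [r = 1 / c] works. *)
Lemma positive_le_scalar A : bounded_operator A -> positive_operator ip A ->
  exists2 r : R, 0 < r & positive_operator ip (idfun - r%:C%C *: A).
Proof.
move=> [lA cA] pA.
pose linA := GRing.isLinear.Build _ _ _ _ A lA.
pose fA : {linear H -> H} := HB.pack A linA.
have /linear_bounded_continuous/linear_boundedP/pinfty_ex_gt0[c c0 Ac] :
  continuous fA by [].
(* The bound [c] lives in [R[i]]; being positive, it is real. *)
have cr : (complex.Re c)%:C%C = c by rewrite RRe_real// gtr0_real.
exists (complex.Re c)^-1; first by rewrite invr_gt0 -ltcR cr.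
move=> x; rewrite -[(_ - _) x]/(x - (complex.Re c)^-1%:C%C *: A x).
rewrite linearBl /= ipZl fmorphV /= cr.
rewrite subr_ge0 mulrC ler_pdivrMr//.
rewrite -(ler_pM2l (x := 2 * c)) ?mulr_gt0 ?ltr0n//.
have h1 : ip (A x) (A x) <= c ^+ 2 * ip x x.
  by rewrite -!ip_norm -exprMn lerXn2r ?nnegrE ?mulr_ge0 ?(ltW c0)//; apply: Ac.
have h2 := dnorm_ge0 ip (c *: x - A x).
have cc : c^* = c by rewrite geC0_conj// ltW.
move: h2; rewrite hnormB expr0 mul1r /= !ipZl !ipZr cc.
rewrite rmorphM /= cc -ipC.
rewrite [ip x (A x)]ipC (geC0_conj (pA x)) subr_ge0 => h2.
apply: (@le_trans _ _ (c * ip (A x) x + c * ip (A x) x)).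
  by rewrite -mulrA mulr2n mulrDl !mul1r.
apply: (le_trans h2); rewrite -subr_ge0.
have -> : 2 * c * (ip x x * c) - (c * (c * ip x x) + ip (A x) (A x)) =
  c ^+ 2 * ip x x - ip (A x) (A x) by ring.
by rewrite subr_ge0.
Qed.
End PositiveOperators.

(** * Traces of products of positive operators *)

Section Trace.
Context {R : realType} {H : completeNormedModType R[i]}.
Context (ip : {dot H for Num.conj}) (ip_norm : inner_product_norm ip).
Context (M : set (H -> H)) (M_vna : von_neumann_algebra ip M).
Context (tau : (H -> H) -> R[i]) (tau_trace : faithful_trace ip M tau).
Implicit Types (A B X : H -> H).

(** The estimates below need a total order, hence the real part. *)
Let t A : R := complex.Re (tau A).

Lemma vna_map_linear A : M A -> linear A.
Proof. by case/(vna_bounded M_vna). Qed.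

Lemma vna0 : M 0.
Proof.
by rewrite -(addNr idfun) -scaleN1r; apply: (vna_linear M_vna); apply: vna_id M_vna.
Qed.

Lemma vnaZ (a : R[i]) A : M A -> M (a *: A).
Proof.
by move=> MA; rewrite -[_ *: _]addr0; apply: (vna_linear M_vna) => //; apply: vna0.
Qed.

Lemma vnaB A B : M A -> M B -> M (A - B).
Proof. by move=> MA MB; rewrite addrC -scaleN1r; apply: (vna_linear M_vna). Qed.

Lemma vnaD A B : M A -> M B -> M (A + B).
Proof. by move=> MA MB; rewrite -[A]scale1r; apply: (vna_linear M_vna). Qed.

Lemma vnaM A B : M A -> M B -> M (A \o B).
Proof. exact: (vna_comp M_vna). Qed.

Lemma vna_sum (I : finType) (a : I -> R[i]) (A : I -> H -> H) :
  (forall i, M (A i)) -> M (\sum_i a i *: A i).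
Proof.
by move=> MA; elim/big_ind: _ => [|B C|i _]; [exact: vna0|exact: vnaD|exact: vnaZ].
Qed.

Lemma tau0 : tau 0 = 0.
Proof.
have /esym := trace_linear tau_trace (-1) (vna_id M_vna) (vna_id M_vna).
by rewrite scaleN1r addNr mulN1r addNr => <-.
Qed.

Lemma tauZ (a : R[i]) A : M A -> tau (a *: A) = a * tau A.
Proof.
by move=> MA; have := trace_linear tau_trace a MA vna0; rewrite tau0 !addr0.
Qed.

Lemma tauD A B : M A -> M B -> tau (A + B) = tau A + tau B.
Proof.
by move=> MA MB; have := trace_linear tau_trace 1 MA MB; rewrite scale1r mul1r.
Qed.

Lemma tauB A B : M A -> M B -> tau (A - B) = tau A - tau B.
Proof.
move=> MA MB; rewrite addrC -scaleN1r (trace_linear tau_trace)//.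
by rewrite mulN1r addrC.
Qed.

Lemma tau_sum (I : finType) (a : I -> R[i]) (A : I -> H -> H) :
  (forall i, M (A i)) -> tau (\sum_i a i *: A i) = \sum_i a i * tau (A i).
Proof.
move=> MA.
suff [] : M (\sum_i a i *: A i) /\
  tau (\sum_i a i *: A i) = \sum_i a i * tau (A i) by [].
elim/big_rec2: _ => [|i y B _ [MB <-]]; first by split; [exact: vna0|exact: tau0].
split; first by apply: (vna_linear M_vna).
exact: (trace_linear tau_trace).
Qed.

Lemma comp_subr X A B : M X -> X \o (A - B) = (X \o A) - (X \o B).
Proof.
move=> /vna_map_linear lX; apply/funext => x.
by rewrite -[LHS]/(X (A x - B x)) (linear_mapB lX).
Qed.

Lemma vna_self_adjoint A : M A -> positive_operator ip A -> is_adjoint ip A A.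
Proof. by move=> /vna_map_linear; apply: positive_self_adjoint. Qed.

(* Substitute for the square root of A:
   [A = A_0^2 + ... + A_(n-1)^2 + A_n] with [A_n = residual A n], and for
   [0 <= A <= 1] every [A_n] is again between [0] and [1]. *)
Fixpoint residual A n : H -> H :=
  if n is n'.+1 then residual A n' - (residual A n' \o residual A n') else A.

(** With [B = A_n], induct using [B - B^2 = (1 - B) B (1 - B) + B (1 - B) B] and
    [1 - (B - B^2) = (1 - B) + B^2]. *)
Lemma residualP A n : M A -> positive_operator ip A ->
  positive_operator ip (idfun - A) ->
  [/\ M (residual A n), positive_operator ip (residual A n) &
      positive_operator ip (idfun - residual A n)].
Proof.
move=> MA pA qA; elim: n => [|n [MB pB qB]] //=.
move: (residual A n) MB pB qB => B MB pB qB.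
have lB := vna_map_linear MB; have sB := vna_self_adjoint MB pB.
split; first by apply: vnaB => //; apply: vnaM.
- move=> x; have -> : ip ((B - (B \o B)) x) x =
    ip (B (x - B x)) (x - B x) + ip ((idfun - B) (B x)) (B x).
    rewrite -[(_ - _) x]/(B x - B (B x)) -[(_ - _) (B x)]/(B x - B (B x)).
    by rewrite (linear_mapB lB) linearBr /= subrK.
  exact: addr_ge0.
- move=> x; have -> : ip ((idfun - (B - (B \o B))) x) x =
    ip ((idfun - B) x) x + ip ((B \o B) x) x.
    rewrite -linearDl /=; congr (ip _ _).
    by rewrite -[LHS]/(x - (B x - B (B x))) opprB addrA addrAC.
  by apply: addr_ge0 => //; apply: positive_sq.
Qed.

Lemma re_tau_ge0 A : M A -> positive_operator ip A -> 0 <= t A.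
Proof.
by move=> MA pA; have := trace_positive tau_trace MA pA; rewrite lecE => /andP[].
Qed.

Lemma re_tauB A B : M A -> M B -> t (A - B) = t A - t B.
Proof. by move=> MA MB; rewrite /t tauB//; case: (tau A); case: (tau B). Qed.

Lemma re_tauD A B : M A -> M B -> t (A + B) = t A + t B.
Proof. by move=> MA MB; rewrite /t tauD//; case: (tau A); case: (tau B). Qed.

Lemma re_tauZ (a : R) A : M A -> t (a%:C%C *: A) = a * t A.
Proof.
by move=> MA; rewrite /t tauZ//; case: (tau A) => x y /=; rewrite mul0r subr0.
Qed.

(** By cyclicity this is the trace of the positive operator [B X B]. *)
Lemma tau_sandwich_ge0 X B : M X -> M B -> positive_operator ip X ->
  is_adjoint ip B B -> 0 <= tau (X \o (B \o B)).
Proof.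
move=> MX MB pX sB.
rewrite -[X \o _]/((X \o B) \o B) (trace_comm tau_trace (vnaM MX MB) MB).
apply: (trace_positive tau_trace); last exact: (positive_comp_sq sB pX).
by do 2!apply: vnaM => //.
Qed.

Lemma re_tau_residual_le n X A : M X -> positive_operator ip X ->
  M A -> positive_operator ip A -> positive_operator ip (idfun - A) ->
  t (X \o residual A n) <= t (X \o A).
Proof.
move=> MX pX MA pA qA; elim: n => //= n; apply: le_trans.
have [MB pB qB] := residualP n MA pA qA; move: (residual A n) MB pB qB => B MB pB _.
rewrite comp_subr// (re_tauB (vnaM MX MB) (vnaM MX (vnaM MB MB))).
rewrite gerBl.
have := tau_sandwich_ge0 MX MB pX (vna_self_adjoint MB pB).
by rewrite lecE => /andP[].
Qed.

(** The sum telescopes, since [A_k^2 = A_k - A_(k+1)], and the remainder [A_n] has nonnegative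
    trace. *)
Lemma re_tau_sum_residual_sq n A : M A -> positive_operator ip A ->
  positive_operator ip (idfun - A) ->
  \sum_(k < n) t (residual A k \o residual A k) <= t A.
Proof.
move=> MA pA qA.
suff -> : \sum_(k < n) t (residual A k \o residual A k) = t A - t (residual A n).
  by have [MB pB _] := residualP n MA pA qA; rewrite gerBl re_tau_ge0.
elim: n => [|n IH]; first by rewrite big_ord0 subrr.
have [MB _ _] := residualP n MA pA qA.
by rewrite big_ord_recr /= IH (re_tauB MB (vnaM MB MB)); ring.
Qed.

(** Expands the trace of [(s X + A)^2]; with a suitable [s] this plays the part of the
    Cauchy-Schwarz inequality. *)
Lemma re_tau_square_ge0 (s : R) X A : M X -> M A -> is_adjoint ip X X ->
  is_adjoint ip A A ->
  0 <= s ^+ 2 * t (X \o X) + 2 * s * t (X \o A) + t (A \o A).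
Proof.
move=> MX MA sX sA.
set Y := s%:C%C *: X + A; have MY : M Y by apply: (vna_linear M_vna).
have sY : is_adjoint ip Y Y.
  move=> x y; rewrite -[Y x]/(s%:C%C *: X x + A x) -[Y y]/(s%:C%C *: X y + A y).
  rewrite linearDl linearDr /= ipZl ipZr sX sA; congr (_ * _ + _).
  by rewrite conj_Creal//; apply/complex_realP; exists s.
have lX := vna_map_linear MX; have lA := vna_map_linear MA.
have -> : s ^+ 2 * t (X \o X) + 2 * s * t (X \o A) + t (A \o A) = t (Y \o Y).
  have -> : Y \o Y = s%:C%C *: (s%:C%C *: (X \o X) + (X \o A)) +
                     (s%:C%C *: (A \o X) + (A \o A)).
    apply/funext => x.
    rewrite -[LHS]/(s%:C%C *: X (s%:C%C *: X x + A x) + A (s%:C%C *: X x + A x)).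
    by rewrite (lX _ _ _) (lA _ _ _).
  have MXX := vnaM MX MX; have MXA := vnaM MX MA.
  have MAX := vnaM MA MX; have MAA := vnaM MA MA.
  have MS := vnaD (vnaZ s%:C%C MXX) MXA.
  rewrite (re_tauD (vnaZ _ MS) (vnaD (vnaZ _ MAX) MAA)) (re_tauZ _ MS).
  rewrite (re_tauD (vnaZ _ MXX) MXA) (re_tauD (vnaZ _ MAX) MAA) !re_tauZ//.
  by rewrite [t (A \o X)]/t (trace_comm tau_trace MA MX) -/(t _); ring.
by apply: re_tau_ge0; [exact: vnaM|exact: positive_sq].
Qed.

(** If [t (X A) = - d < 0], then [t (X A_k) <= - d] for all [k], which keeps every [t (A_k^2)] above
    a fixed positive number, although their partial sums are bounded by [t A]. *)
Lemma re_tau_contraction_ge0 X A : M X -> positive_operator ip X ->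
  M A -> positive_operator ip A -> positive_operator ip (idfun - A) ->
  0 <= t (X \o A).
Proof.
move=> MX pX MA pA qA; rewrite leNgt; apply/negP => neg.
set d := - t (X \o A); have d0 : 0 < d by rewrite oppr_gt0.
have sX := vna_self_adjoint MX pX.
set a := t (X \o X).
have a0 : 0 <= a by apply: re_tau_ge0; [exact: vnaM|exact: positive_sq].
(* Adding 1 keeps the denominator positive when [a = 0], and still gives [s a <= d], whence
   [2 s d - s^2 a >= s d]. *)
pose s := d / (a + 1); have s0 : 0 < s by rewrite divr_gt0// ltr_wpDl.
have sa : s * a <= d.
  by rewrite /s mulrAC ler_pdivrMr ?ltr_wpDl// ler_pM2l// lerDl.
have lb k : s * d <= t (residual A k \o residual A k).
  have [MB pB _] := residualP k MA pA qA.
  have h1 := re_tau_residual_le k MX pX MA pA qA.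
  have h2 := re_tau_square_ge0 s MX MB sX (vna_self_adjoint MB pB).
  rewrite -/a in h2.
  have h3 : s * t (X \o residual A k) <= s * (- d) by rewrite ler_pM2l// opprK.
  have h4 : s * (s * a) <= s * d by rewrite ler_pM2l.
  lra.
have e0 : 0 < s * d by rewrite mulr_gt0.
(* More than [t A / (s d)] terms, each at least [s d], exceed the bound [t A]. *)
have := re_tau_sum_residual_sq (Num.Def.archi_bound (t A / (s * d))) MA pA qA.
set n := Num.Def.archi_bound _ => h.
have : n%:R * (s * d) <= t A.
  apply: le_trans h; rewrite mulr_natl -{1}(card_ord n) -sumr_const.
  exact: ler_sum.
rewrite -ler_pdivlMr// leNgt; apply/negP; rewrite negbK.
apply: archi_boundP; rewrite divr_ge0 ?(ltW e0)//; exact: re_tau_ge0.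
Qed.

(* If [0 <= A <= 1], both summands of
   [tau (X A) = tau (X A^2) + tau (X (A - A^2))] are nonnegative. *)
Lemma tau_comp_sq_eq0 X A : M X -> positive_operator ip X ->
  M A -> positive_operator ip A -> tau (X \o A) = 0 -> tau (X \o (A \o A)) = 0.
Proof.
move=> MX pX MA pA XA0.
have [r r0 qA] := positive_le_scalar ip_norm (vna_bounded M_vna MA) pA.
set B := r%:C%C *: A in qA; have MB : M B by apply: vnaZ.
have pB : positive_operator ip B by apply: positive_scale => //; rewrite ler0c ltW.
have lX := vna_map_linear MX; have lA := vna_map_linear MA.
have XB : X \o B = r%:C%C *: (X \o A).
  by apply/funext => x; apply: (linear_mapZ lX).
have XBB : X \o (B \o B) = (r ^+ 2)%:C%C *: (X \o (A \o A)).
  apply/funext => x; rewrite -[LHS]/(X (r%:C%C *: A (r%:C%C *: A x))).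
  by rewrite (linear_mapZ lA) !(linear_mapZ lX) scalerA -rmorphM.
have MXA := vnaM MX MA; have MXAA := vnaM MX (vnaM MA MA).
(* As the trace of [X B] vanishes, nonnegativity for [B - B^2] says [t (X A^2) <= 0]. *)
have [MB1 pB1 qB1] := residualP 1 MB pB qA.
have := re_tau_contraction_ge0 MX pX MB1 pB1 qB1.
rewrite /= comp_subr// re_tauB ?XB ?XBB ?re_tauZ//; try exact: vnaZ.
rewrite {1}/t XA0 mulr0 sub0r oppr_ge0 pmulr_rle0 ?exprn_gt0// => le0.
have ge0 := tau_sandwich_ge0 MX MA pX (vna_self_adjoint MA pA).
apply/eqP; rewrite eq_le ge0 andbT lecE le0 andbT.
by move: ge0; rewrite lecE => /andP[/eqP ->].
Qed.

(** Squaring one factor at a time keeps the trace zero; the resulting trace of [B^2 A^2] is, by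
    cyclicity, that of [(A B)^* (A B)], so faithfulness applies. *)
Lemma tau_comp_eq0 A B : M A -> positive_operator ip A ->
  M B -> positive_operator ip B -> tau (A \o B) = 0 -> A \o B = 0.
Proof.
move=> MA pA MB pB AB0.
have sA := vna_self_adjoint MA pA; have sB := vna_self_adjoint MB pB.
have h1 := tau_comp_sq_eq0 MA pA MB pB AB0.
rewrite (trace_comm tau_trace MA (vnaM MB MB)) in h1.
have h2 := tau_comp_sq_eq0 (vnaM MB MB) (positive_sq sB) MA pA h1.
apply: (trace_faithful tau_trace (B := B \o A)); first exact: vnaM.
  by move=> x y /=; rewrite sA sB.
rewrite -[_ \o _]/(B \o (A \o A \o B)) 
  (trace_comm tau_trace MB (vnaM (vnaM MA MA) MB)).
by rewrite -[_ \o _]/((A \o A) \o (B \o B))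
  (trace_comm tau_trace (vnaM MA MA) (vnaM MB MB)).
Qed.

Lemma tau_sq_eq0 A : M A -> is_adjoint ip A A -> tau (A \o A) = 0 -> A = 0.
Proof. by move=> MA sA; apply: (trace_faithful tau_trace). Qed.

(* [D = \sum_i w_i A_i] is self-adjoint and [tau (D^2) = |\sum_i w_i v_i|^2]. *)
Lemma realization_relation (I : finType) (n : nat) (v : I -> 'rV[R]_n)
    (A : I -> H -> H) (w : I -> R) :
  (forall i, M (A i)) -> (forall i, positive_operator ip (A i)) ->
  (forall i j, tau (A i \o A j) = (inner (v i) (v j))%:C%C) ->
  \sum_i w i *: v i = 0 -> \sum_i (w i)%:C%C *: A i = 0.
Proof.
move=> MA pA tA w0.
set D := \sum_i _; have MD : M D by apply: vna_sum.
have sD : is_adjoint ip D D.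
  by apply: self_adjoint_sum => i; apply: vna_self_adjoint.
apply: tau_sq_eq0 => //.
have := inner_sum w v; rewrite w0 /inner mul0mx mxE => /esym h0.
rewrite {1}/D comp_suml tau_sum; last by move=> i; apply: vnaM.
transitivity ((\sum_i w i * \sum_j w j * inner (v i) (v j))%:C%C); last by rewrite h0.
rewrite rmorph_sum; apply: eq_bigr => i _; rewrite rmorphM; congr (_ * _).
rewrite comp_sumr; last exact: vna_map_linear.
rewrite tau_sum; last by move=> j; apply: vnaM.
by rewrite rmorph_sum; apply: eq_bigr => j _; rewrite rmorphM tA.
Qed.

(** The relation among the vectors has weights [1, -1, -r, r]; it is transferred to the operators
    and solved for [A i x], ready for rewriting. *)
Lemma realization_chord (I : finType) (n : nat) (v : I -> 'rV[R]_n)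
    (A : I -> H -> H) (r : R) (i j k l : I) :
  (forall i, M (A i)) -> (forall i, positive_operator ip (A i)) ->
  (forall i j, tau (A i \o A j) = (inner (v i) (v j))%:C%C) ->
  v i - v j = r *: (v k - v l) ->
  forall x, A i x = A j x + r%:C%C *: (A k x - A l x).
Proof.
move=> MA pA tA vr x; pose f (m : 'I_4) := nth i [:: i; j; k; l] m.
have := @realization_relation 'I_4 n (v \o f) (A \o f)
  (fun m => [:: 1; -1; - r; r]`_m) (fun=> MA _) (fun=> pA _) (fun _ _ => tA _ _).
rewrite !big_ord_recl !big_ord0 /f /= !addr0.
set s := (X in X = 0 -> _); have s0 : s = 0.
  by rewrite /s scale1r scaleN1r scaleNr addrA vr scalerBr addrACA subrr add0r addNr.
move=> /(_ s0)/(congr1 (fun B => B x)).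
rewrite -[X in X = _]/(1%:C%C *: A i x + ((-1)%:C%C *: A j x +
  ((- r)%:C%C *: A k x + r%:C%C *: A l x))) -[RHS]/0.
rewrite rmorph1 !rmorphN rmorph1 scale1r scaleN1r scaleNr => h.
apply/eqP; rewrite -subr_eq0 -h scalerBr opprD opprB.
by rewrite [- (_ *: _) + _]addrC.
Qed.

End Trace.

Theorem theorem3p1 (R : realType) (H : completeNormedModType R[i])
    (ip : {dot H for Num.conj}) (ip_norm : inner_product_norm ip)
    (M : set (H -> H)) (M_vna : von_neumann_algebra ip M)
    (tau : (H -> H) -> R[i]) (tau_trace : faithful_trace ip M tau) :
  ~ exists A : 'Z_5 -> H -> H,
      (forall k : 'Z_5, M (A k) /\ positive_operator ip (A k)) /\
      (forall j k : 'Z_5, tau (A j \o A k) = (inner (pentagon_vec j) (pentagon_vec k))%:C%C).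
Proof.
move=> [A [MpA tA]].
have MA k : M (A k) by case: (MpA k).
have pA k : positive_operator ip (A k) by case: (MpA k).
have [z02 z03 z14] := @pentagon_orthogonal R; have [e1 e4] := @pentagon_chord R.
pose r : R := 2 * cos (pi / 5) - 1; rewrite -/r in e1 e4.
(* [r = 0] would give [cos (pi / 5) = 1 / 2], which violates the quadratic equation. *)
have r0 : r != 0.
  apply/eqP => r0; have c : cos (pi / 5) = 1 / 2 :> R by rewrite /r in r0; lra.
  by have := @cos_pi5_root R; rewrite c; lra.
have prod0 j k : inner (pentagon_vec j) (pentagon_vec k) = 0 :> R ->
    forall x, A j (A k x) = 0.
  move=> h x; have /(congr1 (@^~ x)) // : A j \o A k = 0.
  by apply: (tau_comp_eq0 ip_norm M_vna tau_trace); rewrite ?tA ?h.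
have E1 := realization_chord M_vna tau_trace MA pA tA e1.
have E4 := realization_chord M_vna tau_trace MA pA tA e4.
have lA0 := vna_map_linear M_vna (MA 0).
have S x : A 0 (A 1 x) = r%:C%C *: A 0 (A 0 x).
  rewrite E1 (linear_mapD lA0) (linear_mapZ lA0) (linear_mapB lA0).
  by rewrite (prod0 _ _ z02) (prod0 _ _ z03) add0r subr0.
have T x : A 0 (A 4 x) = r%:C%C *: A 0 (A 0 x).
  rewrite E4 (linear_mapD lA0) (linear_mapZ lA0) (linear_mapB lA0).
  by rewrite (prod0 _ _ z02) (prod0 _ _ z03) add0r subr0.
(* Evaluate [A_0 A_1 = r A_0^2] at [A_4 x]: the left side vanishes and the right side is
   [r^2 A_0^3 x]. *)
have cube0 x : A 0 (A 0 (A 0 x)) = 0.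
  have := S (A 4 x); rewrite (prod0 _ _ z14) (linear_map0 lA0) T (linear_mapZ lA0).
  rewrite scalerA => /esym/eqP; rewrite scaler_eq0 -rmorphM fmorph_eq0 mulf_eq0.
  by rewrite (negbTE r0) => /eqP.
have sA0 := vna_self_adjoint M_vna (MA 0) (pA 0).
have MA2 := vnaM M_vna (MA 0) (MA 0).
(* [A_0^2] is self-adjoint with square [A_0^4 = 0], so faithfulness kills it. *)
have sq0 : A 0 \o A 0 = 0.
  apply: (tau_sq_eq0 tau_trace MA2) => [x y|]; first by rewrite /= !sA0.
  rewrite (_ : _ \o _ = 0) ?(tau0 M_vna tau_trace)//.
  by apply/funext => x; exact: cube0.
have := tA 0 0; rewrite sq0 (tau0 M_vna tau_trace) => /esym/eqP.
by rewrite fmorph_eq0 (negbTE (@pentagon_norm R)).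
Qed.
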